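(* Let $p\colon\mathcal E\to\mathcal B$ be a cartesian 2-fibration represented by an object $x$ of $\mathcal B$, and let $\bar x$ be the associated lift of $x$ in $\mathcal E$. Let $M_{\mathrm{cart}}$ denote the collection of $p$-cartesian 1-cells of $\mathcal E$. Then $\bar x$ is $M_{\mathrm{cart}}$-final in $\mathcal E$.
   Context: 2-categories and 2-functors are strict; composition of 1-cells and whiskering are written by juxtaposition, and $\circ$ denotes vertical composition of 2-cells. Cartesian cells and 2-fibrations. For a 2-functor $p\colon\mathcal E\to\mathcal B$, a 1-cell $f\colon u\to v$ of $\mathcal E$ is $p$-cartesian if for every object $a$ of $\mathcal E$ the square with $f\circ-\colon\mathcal E(a,u)\to\mathcal E(a,v)$ over $p(f)\circ-\colon\mathcal B(pa,pu)\to\mathcal B(pa,pv)$ is a (strict) pullback of categories. A 2-cell in $\mathcal E(u,v)$ is $p$-cartesian if it is a cartesian arrow for the functor $p_{u,v}\colon\mathcal E(u,v)\to\mathcal B(pu,pv)$. The 2-functor $p$ is a (cartesian) 2-fibration if every 1-cell $b\to p(e)$ of $\mathcal B$ has a $p$-cartesian lift with target $e$, every $p_{u,v}$ is a Grothendieck fibration, and $p$-cartesian 2-cells are closed under horizontal composition. Lax slice $\mathcal B_{/x}$. Objects: pairs $(y,\alpha)$ with $\alpha\colon y\to x$. 1-cells $(y,\alpha)\to(z,\beta)$: pairs $(f,\gamma)$ with $f\colon y\to z$ and a 2-cell $\gamma\colon\beta f\to\alpha$. 2-cells $(f,\gamma)\to(g,\delta)$: 2-cells $\Xi\colon f\to g$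 with $\delta\circ(\beta\Xi)=\gamma$. Composition: $(g,\delta)(f,\gamma)=(gf,\ \gamma\circ(\delta f))$. It has an evident projection to $\mathcal B$. Represented: $p$ is represented by $x$ if it is the fibration classifying the 2-functor $\mathcal B(-,x)\colon\mathcal B^{\mathrm{op}}\to\mathrm{Cat}$ via the Grothendieck construction; concretely, this means that $\mathcal E$ is identified with $\mathcal B_{/x}$ by an isomorphism of 2-categories over $\mathcal B$. The associated lift $\bar x$ is the object of $\mathcal E$ corresponding to $(x,1_x)\in\mathcal B_{/x}$ under this isomorphism. $M$-final object. Let $M$ be a class of 1-cells of a 2-category $\mathcal D$ containing all identities (its elements are called marked). An object $c$ of $\mathcal D$ is $M$-final if: (1) for every object $a$ the category $\mathcal D(a,c)$ has a terminal object; (2) $1_c$ is terminal in $\mathcal D(c,c)$; (3) for every object $a$ there exists a marked 1-cell $a\to c$; (4) for every marked 1-cell $f\colon a\to b$, the precomposition functor $f^*\colon\mathcal D(b,c)\to\mathcal D(a,c)$ preserves terminal objects. *)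

(* Defs.v *)
From Stdlib Require Import FunctionalExtensionality ProofIrrelevance.

Set Implicit Arguments.
Unset Strict Implicit.
Unset Printing Implicit Defensive.

Declare Scope cat_scope.
Delimit Scope cat_scope with cat.
Local Open Scope cat_scope.

Reserved Notation "g ∘ f" (at level 40, left associativity).
Reserved Notation "g · f" (at level 40, left associativity).
Reserved Notation "b ⋆ a" (at level 40, left associativity).
Reserved Notation "f ≅ g" (at level 70, no associativity).

Record Category := {
  obj :> Type;
  arr : obj -> obj -> Type;
  idn : forall a, arr a a;
  comp : forall a b c, arr b c -> arr a b -> arr a c;
  comp_assoc : forall a b c d (h : arr c d) (g : arr b c) (f : arr a b),
    comp h (comp g f) = comp (comp h g) f;
  comp_id_l : forall a b (f : arr a b), comp (idn b) f = f;
  comp_id_r : forall a b (f : arr a b), comp f (idn a) = f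
}.
Arguments arr {_} _ _.
Arguments idn {_} _.
Arguments comp {_ _ _ _} _ _.
Notation "g ∘ f" := (comp g f) : cat_scope.

(* [f ≅ g] is equality of arrows whose endpoints are only propositionally
   equal: the triples (source, target, arrow) coincide. *)
Definition tot {C : Category} {a b : C} (f : arr a b) :
    {a : C & {b : C & arr a b}} :=
  existT _ a (existT _ b f).
Notation "f ≅ g" := (tot f = tot g) : cat_scope.

Definition eq_arr {C : Category} {a b : C} (e : a = b) : arr a b :=
  match e in _ = b' return arr a b' with eq_refl => idn a end.

Record Functor (C D : Category) := {
  fobj :> C -> D;
  fmap : forall a b : C, arr a b -> arr (fobj a) (fobj b);
  fmap_id : forall a, fmap (idn a) = idn (fobj a);
  fmap_comp : forall a b c (g : arr b c) (f : arr a b),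
    fmap (g ∘ f) = fmap g ∘ fmap f
}.
Arguments fmap {_ _} _ {_ _} _.

Definition functor_id (C : Category) : Functor C C.
Proof.
  refine {| fobj := fun a => a; fmap := fun a b f => f |}; reflexivity.
Defined.

Definition functor_comp {C D E : Category} (G : Functor D E) (F : Functor C D) :
  Functor C E.
Proof.
  refine {| fobj := fun a => G (F a); fmap := fun a b f => fmap G (fmap F f) |}.
  - intros; now rewrite !fmap_id.
  - intros; now rewrite !fmap_comp.
Defined.

Definition prod_cat (C D : Category) : Category.
Proof.
  refine {| obj := (C * D)%type;
            arr := fun u v => (arr (fst u) (fst v) * arr (snd u) (snd v))%type;
            idn := fun u => (idn (fst u), idn (snd u));
            comp := fun u v w g f => (fst g ∘ fst f, snd g ∘ snd f) |}.
  - intros; simpl; now rewrite !comp_assoc.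
  - intros a b [f f']; simpl; now rewrite !comp_id_l.
  - intros a b [f f']; simpl; now rewrite !comp_id_r.
Defined.

Definition terminal {C : Category} (t : C) : Prop :=
  forall a : C, exists f : arr a t, forall g : arr a t, g = f.

Definition preserves_terminal {C D : Category} (F : Functor C D) : Prop :=
  forall t : C, terminal t -> terminal (F t).

(* The square    P --top--> A
                 |          |
               left       right
                 v          v
                 C -bottom-> D    is a strict pullback in Cat. *)
Definition is_pullback {P A C D : Category}
    (top : Functor P A) (left : Functor P C)
    (right : Functor A D) (bottom : Functor C D) : Prop :=
  functor_comp right top = functor_comp bottom left /\
  forall (X : Category) (S : Functor X A) (T : Functor X C),
    functor_comp right S = functor_comp bottom T ->
    exists! L : Functor X P, functor_comp top L = S /\ functor_comp left L = T.

Definition cartesian_arrow {E B : Category} (p : Functor E B)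
    {u v : E} (f : arr u v) : Prop :=
  forall (w : E) (g : arr w v) (h : arr (p w) (p u)),
    fmap p f ∘ h = fmap p g ->
    exists! k : arr w u, f ∘ k = g /\ fmap p k = h.

Definition grothendieck_fibration {E B : Category} (p : Functor E B) : Prop :=
  forall (e : E) (b : B) (g : arr b (p e)),
  exists (e' : E) (f : arr e' e),
    cartesian_arrow p f /\
    existT (fun b' => arr b' (p e)) (p e') (fmap p f) = existT _ b g.

(* A 2-category is a category enriched in Cat.  The objects and arrows of
   [hom a b] are the 1-cells and 2-cells, [∘] is vertical composition, and
   [comp1] is composition of 1-cells ([g · f], written gf in juxtaposition)
   together with horizontal composition of 2-cells ([b ⋆ a]).  Each of the
   three strict laws is an equality of functors, given on objects and on
   arrows. *)
Record TwoCategory := {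
  ob :> Type;
  hom : ob -> ob -> Category;
  id1 : forall a, hom a a;
  comp1 : forall a b c, Functor (prod_cat (hom b c) (hom a b)) (hom a c);
  assoc1 : forall a b c d (h : hom c d) (g : hom b c) (f : hom a b),
    comp1 a c d (h, comp1 a b c (g, f)) = comp1 a b d (comp1 b c d (h, g), f);
  assoc2 : forall a b c d (h h' : hom c d) (g g' : hom b c) (f f' : hom a b)
      (th : arr h h') (be : arr g g') (al : arr f f'),
    fmap (comp1 a c d) (a := (h, _)) (b := (h', _))
      (th, fmap (comp1 a b c) (a := (g, f)) (b := (g', f')) (be, al)) ≅
    fmap (comp1 a b d) (a := (_, f)) (b := (_, f'))
      (fmap (comp1 b c d) (a := (h, g)) (b := (h', g')) (th, be), al);
  unit1_l : forall a b (f : hom a b), comp1 a b b (id1 b, f) = f;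
  unit2_l : forall a b (f f' : hom a b) (al : arr f f'),
    fmap (comp1 a b b) (a := (id1 b, f)) (b := (id1 b, f'))
      (idn (id1 b), al) ≅ al;
  unit1_r : forall a b (f : hom a b), comp1 a a b (f, id1 a) = f;
  unit2_r : forall a b (f f' : hom a b) (al : arr f f'),
    fmap (comp1 a a b) (a := (f, id1 a)) (b := (f', id1 a))
      (al, idn (id1 a)) ≅ al
}.
Arguments hom {_} _ _.
Arguments id1 {_} _.
Arguments comp1 {_} _ _ _.

Notation "g · f" := (fobj (comp1 _ _ _) (g, f)) : cat_scope.

Definition hcomp {B : TwoCategory} {a b c : B} {g g' : hom b c} {f f' : hom a b}
    (be : arr g g') (al : arr f f') : arr (g · f) (g' · f') :=
  fmap (comp1 a b c) (a := (g, f)) (b := (g', f')) (be, al).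
Notation "b ⋆ a" := (hcomp b a) : cat_scope.

Definition whisker_l {B : TwoCategory} {a b c : B} (g : hom b c)
    {f f' : hom a b} (al : arr f f') : arr (g · f) (g · f') := idn g ⋆ al.

Definition whisker_r {B : TwoCategory} {a b c : B} {g g' : hom b c}
    (be : arr g g') (f : hom a b) : arr (g · f) (g' · f) := be ⋆ idn f.

Definition postcomp {B : TwoCategory} (a : B) {u v : B} (f : hom u v) :
  Functor (hom a u) (hom a v).
Proof.
  refine {| fobj := fun h : hom a u => f · h;
            fmap := fun h h' al => whisker_l f al |}.
  - intros h; exact (fmap_id (comp1 a u v) (f, h)).
  - intros h h' h'' be al; unfold whisker_l, hcomp.
    rewrite <- fmap_comp; simpl; now rewrite comp_id_l.
Defined.

Definition precomp {B : TwoCategory} {a b : B} (f : hom a b) (c : B) :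
  Functor (hom b c) (hom a c).
Proof.
  refine {| fobj := fun h : hom b c => h · f;
            fmap := fun h h' al => whisker_r al f |}.
  - intros h; exact (fmap_id (comp1 a b c) (h, f)).
  - intros h h' h'' be al; unfold whisker_r, hcomp.
    rewrite <- fmap_comp; simpl; now rewrite comp_id_l.
Defined.

Record TwoFunctor (E B : TwoCategory) := {
  fob :> E -> B;
  fhom : forall a b : E, Functor (hom a b) (hom (fob a) (fob b));
  fhom_id1 : forall a, fhom a a (id1 a) = id1 (fob a);
  fhom_comp1 : forall a b c (g : hom b c) (f : hom a b),
    fhom a c (g · f) = fhom b c g · fhom a b f;
  fhom_comp2 : forall a b c (g g' : hom b c) (f f' : hom a b)
      (be : arr g g') (al : arr f f'),
    fmap (fhom a c) (be ⋆ al) ≅ fmap (fhom b c) be ⋆ fmap (fhom a b) al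
}.
Arguments fhom {_ _} _ {_ _}.

Lemma tot_fmap {C D : Category} (F : Functor C D) {a b a' b' : C}
    (f : arr a b) (f' : arr a' b') : f ≅ f' -> fmap F f ≅ fmap F f'.
Proof.
  intros H.
  exact (f_equal (fun t : {a : C & {b : C & arr a b}} =>
                    tot (fmap F (projT2 (projT2 t)))) H).
Qed.

Definition two_functor_id (E : TwoCategory) : TwoFunctor E E.
Proof.
  refine {| fob := fun a => a; fhom := fun a b => functor_id (hom a b) |};
  reflexivity.
Defined.

Definition two_functor_comp {C D E : TwoCategory}
    (G : TwoFunctor D E) (F : TwoFunctor C D) : TwoFunctor C E.
Proof.
  refine {| fob := fun a => G (F a);
            fhom := fun a b => functor_comp (fhom G) (@fhom _ _ F a b) |}.
  - intros a; simpl; now rewrite !fhom_id1.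
  - intros a b c g f; simpl; now rewrite !fhom_comp1.
  - intros a b c g g' f f' be al; simpl.
    eapply eq_trans; [apply tot_fmap, fhom_comp2 | apply fhom_comp2].
Defined.

(* The square   E(a,u) ----- f∘- -----> E(a,v)
                  |                       |
                  v                       v
               B(pa,pu) -- p(f)∘- --> B(pa,pv)    *)
Definition cartesian1 {E B : TwoCategory} (p : TwoFunctor E B)
    {u v : E} (f : hom u v) : Prop :=
  forall a : E,
    is_pullback (postcomp a f) (@fhom _ _ p a u)
                (@fhom _ _ p a v) (postcomp (p a) (fhom p f)).

Definition cartesian2 {E B : TwoCategory} (p : TwoFunctor E B)
    {u v : E} {f g : hom u v} (al : arr f g) : Prop :=
  cartesian_arrow (@fhom _ _ p u v) al.

Definition two_fibration {E B : TwoCategory} (p : TwoFunctor E B) : Prop :=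
  (forall (e : E) (b : B) (g : hom b (p e)),
     exists (e' : E) (f : hom e' e),
       cartesian1 p f /\
       existT (fun b' : B => obj (hom b' (p e))) (p e') (fhom p f)
         = existT _ b g) /\
  (forall u v : E, grothendieck_fibration (@fhom _ _ p u v)) /\
  (forall (u v w : E) (g g' : hom v w) (f f' : hom u v)
          (be : arr g g') (al : arr f f'),
     cartesian2 p be -> cartesian2 p al -> cartesian2 p (be ⋆ al)).

Lemma tot_inj {C : Category} {a b : C} (f g : arr a b) : f ≅ g -> f = g.
Proof.
  intros H; apply inj_pair2 in H; now apply inj_pair2 in H.
Qed.

Lemma tot_comp {C : Category} {a b c a' b' c' : C}
    (g : arr b c) (f : arr a b) (g' : arr b' c') (f' : arr a' b') :
  g ≅ g' -> f ≅ f' -> g ∘ f ≅ g' ∘ f'.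
Proof.
  intros Hg Hf.
  assert (a = a') by exact (f_equal (@projT1 _ _) Hf).
  assert (b = b') by exact (f_equal (@projT1 _ _) Hg).
  assert (c = c') by exact (f_equal (fun t => projT1 (projT2 t)) Hg).
  subst. apply tot_inj in Hg. apply tot_inj in Hf. now subst.
Qed.

Lemma tot_eq_arr_r {C : Category} {a a' b : C} (e : a' = a) (f : arr a b) :
  f ∘ eq_arr e ≅ f.
Proof. destruct e; simpl; now rewrite comp_id_r. Qed.

Lemma tot_hcomp {B : TwoCategory} {a b c : B} {g g' h h' : hom b c}
    {f f' k k' : hom a b} (be : arr g g') (al : arr f f')
    (be' : arr h h') (al' : arr k k') :
  be ≅ be' -> al ≅ al' -> be ⋆ al ≅ be' ⋆ al'.
Proof.
  intros Hg Hf.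
  assert (g = h) by exact (f_equal (@projT1 _ _) Hg).
  assert (g' = h') by exact (f_equal (fun t => projT1 (projT2 t)) Hg).
  assert (f = k) by exact (f_equal (@projT1 _ _) Hf).
  assert (f' = k') by exact (f_equal (fun t => projT1 (projT2 t)) Hf).
  subst. apply tot_inj in Hg. apply tot_inj in Hf. now subst.
Qed.

Lemma tot_idn {C : Category} {a b : C} : a = b -> idn a ≅ idn b.
Proof. now intros ->. Qed.

Lemma interchange {B : TwoCategory} {a b c : B} {g g' g'' : hom b c}
    {f f' f'' : hom a b} (be' : arr g' g'') (be : arr g g')
    (al' : arr f' f'') (al : arr f f') :
  (be' ⋆ al') ∘ (be ⋆ al) = (be' ∘ be) ⋆ (al' ∘ al).
Proof. unfold hcomp; now rewrite <- fmap_comp. Qed.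

Lemma hcomp_idn {B : TwoCategory} {a b c : B} (g : hom b c) (f : hom a b) :
  idn g ⋆ idn f = idn (g · f).
Proof. exact (fmap_id (comp1 a b c) (g, f)). Qed.

Lemma hcomp_assoc {B : TwoCategory} {a b c d : B} {h h' : hom c d}
    {g g' : hom b c} {f f' : hom a b}
    (th : arr h h') (be : arr g g') (al : arr f f') :
  th ⋆ (be ⋆ al) ≅ (th ⋆ be) ⋆ al.
Proof. apply assoc2. Qed.

Lemma hcomp_unit_l {B : TwoCategory} {a b : B} {f f' : hom a b}
    (al : arr f f') : idn (id1 b) ⋆ al ≅ al.
Proof. apply unit2_l. Qed.

Lemma hcomp_unit_r {B : TwoCategory} {a b : B} {f f' : hom a b}
    (al : arr f f') : al ⋆ idn (id1 a) ≅ al.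
Proof. apply unit2_r. Qed.

Section LaxSlice.
Variables (B : TwoCategory) (x : B).

Record SliceOb := { base : B; leg : hom base x }.

Record Slice1 (u v : SliceOb) := {
  cell1 : hom (base u) (base v);
  fill : arr (leg v · cell1) (leg u)
}.

Record Slice2 (u v : SliceOb) (s t : Slice1 u v) := {
  cell2 : arr (cell1 s) (cell1 t);
  cell2_fill : fill t ∘ whisker_l (leg v) cell2 = fill s
}.

Lemma slice1_eq u v (s t : Slice1 u v) :
  cell1 s = cell1 t -> fill s ≅ fill t -> s = t.
Proof.
  destruct s as [f ga], t as [f' ga']; simpl; intros e; subst f'.
  intros H; apply tot_inj in H; now subst.
Qed.

Lemma slice2_eq u v (s t : Slice1 u v) (X Y : Slice2 s t) :
  cell2 X = cell2 Y -> X = Y.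
Proof.
  destruct X as [X HX], Y as [Y HY]; simpl; intros <-.
  f_equal; apply proof_irrelevance.
Qed.

Definition slice_hom (u v : SliceOb) : Category.
Proof.
  refine {| obj := Slice1 u v;
            arr := @Slice2 u v;
            idn := fun s => {| cell2 := idn (cell1 s) |};
            comp := fun s t r Y X => {| cell2 := cell2 Y ∘ cell2 X |} |}.
  - intros; apply slice2_eq; apply comp_assoc.
  - intros; apply slice2_eq; apply comp_id_l.
  - intros; apply slice2_eq; apply comp_id_r.
  Unshelve.
  + unfold whisker_l; rewrite hcomp_idn; apply comp_id_r.
  + transitivity (fill r ∘ (whisker_l (leg v) (cell2 Y) ∘
                            whisker_l (leg v) (cell2 X))).
    * unfold whisker_l; now rewrite interchange, comp_id_l.
    * now rewrite comp_assoc, !cell2_fill.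
Defined.

Lemma slice2_tot u v (s t s' t' : slice_hom u v) (X : arr s t) (Y : arr s' t') :
  s = s' -> t = t' -> cell2 X ≅ cell2 Y -> X ≅ Y.
Proof.
  intros <- <- H; apply tot_inj in H.
  now rewrite (slice2_eq H).
Qed.

(* (g,δ)(f,γ) = (gf, γ ∘ (δ f)), where [eq_arr assoc1] only records that
   ε(gf) and (εg)f are equal 1-cells. *)
Definition slice_comp_ob (u v w : SliceOb) (t : Slice1 v w) (s : Slice1 u v) :
    Slice1 u w :=
  {| cell1 := cell1 t · cell1 s;
     fill := fill s ∘ (whisker_r (fill t) (cell1 s)
               ∘ eq_arr (assoc1 (leg w) (cell1 t) (cell1 s))) |}.

Lemma tot_slice_fill u v w (t : Slice1 v w) (s : Slice1 u v) :
  fill (slice_comp_ob t s) ≅ fill s ∘ whisker_r (fill t) (cell1 s).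
Proof. apply tot_comp; [reflexivity | apply tot_eq_arr_r]. Qed.

Definition slice_comp1 (u v w : SliceOb) :
  Functor (prod_cat (slice_hom v w) (slice_hom u v)) (slice_hom u w).
Proof.
  unshelve refine
    {| fobj := fun ts : prod_cat (slice_hom v w) (slice_hom u v) =>
                 slice_comp_ob (fst ts) (snd ts) : slice_hom u w;
       fmap := fun ts ts' YX =>
                 @Build_Slice2 u w (slice_comp_ob (fst ts) (snd ts))
                   (slice_comp_ob (fst ts') (snd ts'))
                   (cell2 (fst YX) ⋆ cell2 (snd YX)) _ |}.
  - destruct ts as [t s], ts' as [t' s'], YX as [Y X]; simpl in *.
    apply tot_inj.
    transitivity (tot (fill s' ∘ whisker_r (fill t') (cell1 s') ∘
                       (whisker_l (leg w) (cell2 Y) ⋆ cell2 X))).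
    { apply tot_comp; [apply tot_slice_fill | apply hcomp_assoc]. }
    eapply eq_trans; [| symmetry; apply (tot_slice_fill t s)].
    f_equal; f_equal.
    rewrite <- (cell2_fill Y), <- (cell2_fill X).
    rewrite <- !comp_assoc; f_equal.
    unfold whisker_l, whisker_r.
    now rewrite !interchange, !comp_id_l, !comp_id_r.
  - intros [t s]; apply slice2_eq; apply hcomp_idn.
  - intros [t s] [t' s'] [t'' s''] [Y' X'] [Y X]; apply slice2_eq; simpl.
    symmetry; apply interchange.
Defined.

Definition slice_id1 (u : SliceOb) : slice_hom u u :=
  {| cell1 := id1 (base u); fill := eq_arr (unit1_r (leg u)) |}.

Lemma slice_assoc1 (u v w z : SliceOb)
    (r : slice_hom w z) (t : slice_hom v w) (s : slice_hom u v) :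
  slice_comp1 u w z (r, slice_comp1 u v w (t, s)) =
  slice_comp1 u v z (slice_comp1 v w z (r, t), s).
Proof.
  apply slice1_eq; [apply assoc1 |].
  eapply eq_trans; [apply tot_slice_fill |].
  eapply eq_trans; [| symmetry; apply tot_slice_fill].
  simpl.
  eapply eq_trans.
  { apply (tot_comp (g' := fill s ∘ whisker_r (fill t) (cell1 s))
             (f' := whisker_r (whisker_r (fill r) (cell1 t)) (cell1 s))).
    - apply tot_comp; [reflexivity | apply tot_eq_arr_r].
    - unfold whisker_r.
      eapply eq_trans; [| apply hcomp_assoc].
      now rewrite hcomp_idn. }
  rewrite <- comp_assoc.
  apply tot_comp; [reflexivity |].
  unfold whisker_r; rewrite interchange.
  apply tot_hcomp; [| now rewrite comp_id_l].
  apply tot_comp; [reflexivity | symmetry; apply tot_eq_arr_r].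
Qed.

Lemma slice_unit1_l (u v : SliceOb) (s : slice_hom u v) :
  slice_comp1 u v v (slice_id1 v, s) = s.
Proof.
  apply slice1_eq; [apply unit1_l |].
  eapply eq_trans; [apply tot_slice_fill |].
  simpl; unfold whisker_r.
  eapply eq_trans; [| apply f_equal, comp_id_r].
  apply tot_comp; [reflexivity |].
  rewrite <- hcomp_idn.
  apply tot_hcomp; [| reflexivity].
  destruct (unit1_r (leg v)); reflexivity.
Qed.

Lemma slice_unit1_r (u v : SliceOb) (s : slice_hom u v) :
  slice_comp1 u u v (s, slice_id1 u) = s.
Proof.
  apply slice1_eq; [apply unit1_r |].
  eapply eq_trans; [apply tot_slice_fill |].
  simpl; unfold whisker_r.
  eapply eq_trans; [| apply f_equal, comp_id_l].
  apply tot_comp; [| apply hcomp_unit_r].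
  destruct (unit1_r (leg u)); reflexivity.
Qed.

Definition LaxSlice : TwoCategory.
Proof.
  refine {| ob := SliceOb; hom := slice_hom; id1 := slice_id1;
            comp1 := slice_comp1;
            assoc1 := slice_assoc1;
            unit1_l := slice_unit1_l;
            unit1_r := slice_unit1_r |}.
  - intros; apply slice2_tot; try apply slice_assoc1; apply hcomp_assoc.
  - intros; apply slice2_tot; try apply slice_unit1_l; apply hcomp_unit_l.
  - intros; apply slice2_tot; try apply slice_unit1_r; apply hcomp_unit_r.
Defined.

Definition slice_proj : TwoFunctor LaxSlice B.
Proof.
  unshelve refine
    {| fob := base : LaxSlice -> B;
       fhom := fun u v : LaxSlice =>
         {| fobj := fun s : hom u v => cell1 s : hom (base u) (base v);
            fmap := fun s t X => cell2 X |} |}; reflexivity.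
Defined.

Definition slice_id_ob : LaxSlice := {| base := x; leg := id1 x |}.

End LaxSlice.

(* An isomorphism of 2-categories E ≅ B/x over B.  The equalities of
   2-functors are on the nose; by function extensionality and proof irrelevance
   they amount to equality on all objects, 1-cells and 2-cells. *)
Record RepresentedBy {E B : TwoCategory} (p : TwoFunctor E B) (x : B) := {
  rep_to : TwoFunctor E (LaxSlice x);
  rep_from : TwoFunctor (LaxSlice x) E;
  rep_from_to : two_functor_comp rep_from rep_to = two_functor_id E;
  rep_to_from : two_functor_comp rep_to rep_from = two_functor_id (LaxSlice x);
  rep_over : two_functor_comp (slice_proj x) rep_to = p
}.

Definition associated_lift {E B : TwoCategory} {p : TwoFunctor E B} {x : B}
    (r : RepresentedBy p x) : E :=
  rep_from r (slice_id_ob x).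

Record Marking (D : TwoCategory) := {
  marked : forall a b : D, hom a b -> Prop;
  marked_id : forall a : D, marked (id1 a)
}.
Arguments marked {_} _ {_ _} _.

Definition M_final {D : TwoCategory} (M : Marking D) (c : D) : Prop :=
  (forall a : D, exists t : hom a c, terminal t) /\
  terminal (id1 c) /\
  (forall a : D, exists f : hom a c, marked M f) /\
  (forall (a b : D) (f : hom a b), marked M f -> preserves_terminal (precomp f c)).

Lemma functor_ext {C D : Category} (F G : Functor C D) :
  (forall a, F a = G a) ->
  (forall a b (f : arr a b), fmap F f ≅ fmap G f) -> F = G.
Proof.
  destruct F as [F0 F1 Fi Fc], G as [G0 G1 Gi Gc]; simpl; intros H0 H1.
  assert (F0 = G0) by now apply functional_extensionality.
  subst G0.
  assert (F1 = G1).
  { do 3 (apply functional_extensionality_dep; intro).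
    apply tot_inj, H1. }
  subst G1; f_equal; apply proof_irrelevance.
Qed.

Lemma postcomp_id1 {B : TwoCategory} (a u : B) :
  postcomp a (id1 u) = functor_id (hom a u).
Proof.
  apply functor_ext.
  - intros h; apply unit1_l.
  - intros h h' al; apply hcomp_unit_l.
Qed.

Lemma functor_comp_id_l {C D : Category} (F : Functor C D) :
  functor_comp (functor_id D) F = F.
Proof. now apply functor_ext. Qed.

Lemma functor_comp_id_r {C D : Category} (F : Functor C D) :
  functor_comp F (functor_id C) = F.
Proof. now apply functor_ext. Qed.

Lemma cartesian1_id {E B : TwoCategory} (p : TwoFunctor E B) (u : E) :
  cartesian1 p (id1 u).
Proof.
  intros a.
  rewrite fhom_id1, !postcomp_id1.
  split.
  - now rewrite functor_comp_id_l, functor_comp_id_r.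
  - intros X S T; rewrite functor_comp_id_l; intros H.
    exists S; split.
    + split; [apply functor_comp_id_l | exact H].
    + intros L [HL _]; now rewrite functor_comp_id_l in HL.
Qed.

Definition M_cart {E B : TwoCategory} (p : TwoFunctor E B) : Marking E :=
  {| marked := fun u v f => cartesian1 p f; marked_id := cartesian1_id p |}.

(* Main.v *)
(** Under the isomorphism E = B/x the object x̄ becomes (x, 1), and
    a 1-cell (f, γ) : (y, α) -> (x, 1) is just a 2-cell γ : f -> α,
    so (f, γ) is terminal in its hom-category iff γ is invertible.
    Likewise a 1-cell (f, γ) of the lax slice is cartesian iff γ is
    invertible: if γ is invertible one divides by it, and conversely a
    cartesian (f, γ) : (y, α) -> (z, β) factors (f, 1) : (y, βf) -> (z, β)
    through some (1, κ), where κ is forced to be inverse to γ.  The marked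
    1-cell required by finality is (α, 1), and invertibility of fillers is
    stable under composition, so precomposition with a cartesian 1-cell
    preserves terminal objects. *)

From Stdlib Require Import IndefiniteDescription.
Require Import Defs.

Set Implicit Arguments.
Unset Strict Implicit.
Unset Printing Implicit Defensive.

Local Open Scope cat_scope.

(** * Invertible arrows and terminal objects *)

Definition invertible {C : Category} {a b : C} (f : arr a b) : Prop :=
  exists g : arr b a, g ∘ f = idn a /\ f ∘ g = idn b.

Lemma invertible_comp {C : Category} {a b c : C} (g : arr b c) (f : arr a b) :
  invertible g -> invertible f -> invertible (g ∘ f).
Proof.
  intros [g' [Hg1 Hg2]] [f' [Hf1 Hf2]]; exists (f' ∘ g'); split.
  - rewrite <- comp_assoc, (comp_assoc g' g f), Hg1, comp_id_l; exact Hf1.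
  - rewrite <- comp_assoc, (comp_assoc f f' g'), Hf2, comp_id_l; exact Hg2.
Qed.

Lemma invertible_idn {C : Category} (a : C) : invertible (idn a).
Proof. exists (idn a); split; apply comp_id_l. Qed.

Lemma invertible_eq_arr {C : Category} {a b : C} (e : a = b) :
  invertible (eq_arr e).
Proof. destruct e; apply invertible_idn. Qed.

Lemma invertible_fmap {C D : Category} (F : Functor C D) {a b : C}
    (f : arr a b) : invertible f -> invertible (fmap F f).
Proof.
  intros [g [H1 H2]]; exists (fmap F g).
  now rewrite <- !fmap_comp, H1, H2, !fmap_id.
Qed.

Lemma invertible_epi {C : Category} {a b c : C} (f : arr a b) (g h : arr b c) :
  invertible f -> g ∘ f = h ∘ f -> g = h.
Proof.
  intros [f' [_ Hf]] H.
  rewrite <- (comp_id_r g), <- (comp_id_r h), <- Hf, !comp_assoc.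
  now rewrite H.
Qed.

Lemma terminal_invertible {C : Category} {s t : C} (f : arr s t) :
  terminal s -> terminal t -> invertible f.
Proof.
  intros Hs Ht.
  destruct (Hs t) as [g _]; exists g; split.
  - destruct (Hs s) as [i Hi]; now rewrite (Hi (g ∘ f)), (Hi (idn s)).
  - destruct (Ht t) as [i Hi]; now rewrite (Hi (f ∘ g)), (Hi (idn t)).
Qed.

Lemma tot_eq_arr {C : Category} {a b : C} (e : a = b) :
  eq_arr e ≅ idn b.
Proof. now destruct e. Qed.

(** * Isomorphisms of categories and the transfer of terminal objects *)

Lemma functor_comp_assoc {A B C D : Category}
    (H : Functor C D) (G : Functor B C) (F : Functor A B) :
  functor_comp H (functor_comp G F) = functor_comp (functor_comp H G) F.
Proof. now apply functor_ext. Qed.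

Definition inverse_functors {C D : Category} (F : Functor C D) (G : Functor D C)
    : Prop :=
  functor_comp G F = functor_id C /\ functor_comp F G = functor_id D.

(** With [K] a variable the equation can be substituted away. For a composite such as [G F] this
    avoids transporting arrows along propositional equalities of objects. *)
Lemma fully_faithful_of_eq_id {C : Category} (K : Functor C C) :
  K = functor_id C ->
  forall a b (phi : arr (K a) (K b)), exists! X : arr a b, fmap K X = phi.
Proof.
  intros -> a b phi; exists phi; split; [reflexivity | now intros ? <-].
Qed.

Lemma inverse_functors_terminal {C D : Category} (F : Functor C D)
    (G : Functor D C) (t : C) :
  inverse_functors F G -> terminal t -> terminal (F t).
Proof.
  intros [HGF HFG] Ht d.
  assert (HG : G (F t) = t) by exact (f_equal (fun K => fobj K t) HGF).
  assert (Ht' : terminal (G (F t))) by now rewrite HG.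
  assert (Hff : forall phi : arr (F (G d)) (F (G (F t))),
             exists! X : arr d (F t), fmap (functor_comp F G) X = phi)
    by exact (fully_faithful_of_eq_id HFG (a := d) (b := F t)).
  destruct (Ht' (G d)) as [g Hg].
  (* The unique arrow [g] into [G (F t)] is pulled back along [F G], which is fully faithful because
     it equals the identity. *)
  destruct (Hff (fmap F g)) as [X [_ HX]].
  exists X; intros Y; symmetry; apply HX; simpl.
  now rewrite (Hg (fmap G Y)).
Qed.

Lemma inverse_functors_sym {C D : Category} (F : Functor C D)
    (G : Functor D C) : inverse_functors F G -> inverse_functors G F.
Proof. intros [H1 H2]; now split. Qed.

Lemma terminal_reflect {C D : Category} (F : Functor C D) (G : Functor D C)
    (t : C) : inverse_functors F G -> terminal (F t) -> terminal t.
Proof.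
  intros HFG Ht.
  rewrite <- (f_equal (fun K => fobj K t) (proj1 HFG) : G (F t) = t).
  exact (inverse_functors_terminal (inverse_functors_sym HFG) Ht).
Qed.

(** * Strict pullbacks of categories *)

Definition point_cat : Category.
Proof.
  refine {| obj := unit; arr := fun _ _ => unit; idn := fun _ => tt;
            comp := fun _ _ _ _ _ => tt |};
    [reflexivity | intros ? ? []; reflexivity | intros ? ? []; reflexivity].
Defined.

Definition const_functor {C : Category} (c : C) : Functor point_cat C.
Proof.
  refine {| fobj := (fun _ => c) : point_cat -> C; fmap := fun _ _ _ => idn c |}.
  - reflexivity.
  - intros; symmetry; apply comp_id_l.
Defined.

Lemma functor_point_eq {C : Category} (F : Functor point_cat C) (c : C) :
  F (tt : point_cat) = c -> F = const_functor c.
Proof.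
  intros <-; apply functor_ext; [now intros [] |].
  intros [] [] [].
  exact (f_equal (fun h => tot h) (fmap_id F (tt : point_cat))).
Qed.

(** Objects are functors out of the one-arrow category, so the universal property is tested on
    [point_cat]. *)
Lemma pullback_obj {P A C D : Category}
    (top : Functor P A) (left : Functor P C)
    (right : Functor A D) (bottom : Functor C D) :
  is_pullback top left right bottom ->
  forall (s : A) (t : C), right s = bottom t ->
  exists! l : P, top l = s /\ left l = t.
Proof.
  intros [_ HP] s t Hst.
  destruct (HP _ (const_functor s) (const_functor t)) as [L [[HL1 HL2] HL]].
  { transitivity (const_functor (right s)); [| symmetry];
      now apply functor_point_eq. }
  exists (L tt); repeat split.
  - exact (f_equal (fun K => fobj K (tt : point_cat)) HL1).
  - exact (f_equal (fun K => fobj K (tt : point_cat)) HL2).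
  - intros l [<- <-].
    rewrite (HL (const_functor l)); [reflexivity |].
    split; now apply functor_point_eq.
Qed.

(** Unique lifting of objects and of arrows determines the mediating functor pointwise; joint
    faithfulness makes it functorial and unique. *)
Lemma pullback_of_obj_arr {P A C D : Category}
    (top : Functor P A) (left : Functor P C)
    (right : Functor A D) (bottom : Functor C D) :
  functor_comp right top = functor_comp bottom left ->
  (forall s t, right s = bottom t -> exists l, top l = s /\ left l = t) ->
  (forall l l', top l = top l' -> left l = left l' -> l = l') ->
  (forall l l' (sg : arr (top l) (top l')) (ta : arr (left l) (left l')),
     fmap right sg ≅ fmap bottom ta ->
     exists la : arr l l', fmap top la = sg /\ fmap left la = ta) ->
  (forall l l' (la la' : arr l l'),
     fmap top la = fmap top la' -> fmap left la = fmap left la' -> la = la') ->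
  is_pullback top left right bottom.
Proof.
  intros Hsq Hex Hinj Hfull Hfaith; split; [exact Hsq |].
  intros X S T HST.
  (* The lifts of [S x] and [T x] match them only up to propositional equality, so lifting and
     faithfulness are restated with [≅]. *)
  assert (Hfull' : forall l l' s s' t t' (sg : arr s s') (ta : arr t t'),
    top l = s /\ left l = t -> top l' = s' /\ left l' = t' ->
    fmap right sg ≅ fmap bottom ta ->
    exists la : arr l l', fmap top la ≅ sg /\ fmap left la ≅ ta).
  { intros l l' s s' t t' sg ta [<- <-] [<- <-] H.
    destruct (Hfull l l' sg ta H) as [la [<- <-]]; now exists la. }
  assert (Hfaith' : forall l1 l1' l2 l2' (la : arr l1 l1') (la' : arr l2 l2'),
    l1 = l2 -> l1' = l2' -> fmap top la ≅ fmap top la' ->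
    fmap left la ≅ fmap left la' -> la ≅ la').
  { intros l1 l1' l2 l2' la la' <- <- H1 H2.
    apply tot_inj in H1; apply tot_inj in H2; now rewrite (Hfaith _ _ la la'). }
  (* Lifts are only known to exist as propositions; building a functor requires choosing them. *)
  pose (L0 := fun x => constructive_indefinite_description _
    (Hex (S x) (T x) (f_equal (fun F => fobj F x) HST))).
  pose (L1 := fun x y (f : arr x y) => constructive_indefinite_description _
    (Hfull' _ _ _ _ _ _ (fmap S f) (fmap T f) (proj2_sig (L0 x))
       (proj2_sig (L0 y)) (f_equal (fun F => tot (fmap F f)) HST))).
  unshelve epose (L :=
    {| fobj := fun x => proj1_sig (L0 x) : P;
       fmap := fun x y f => proj1_sig (L1 x y f) |}).
  - intros x; simpl; destruct (L1 x x (idn x)) as [la [H1 H2]]; simpl.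
    destruct (proj2_sig (L0 x)) as [K1 K2].
    apply tot_inj, Hfaith'; trivial.
    + rewrite H1, !fmap_id; now apply tot_idn.
    + rewrite H2, !fmap_id; now apply tot_idn.
  - intros x y z g f; simpl.
    destruct (L1 x z (g ∘ f)) as [la [H1 H2]].
    destruct (L1 x y f) as [lf [Hf1 Hf2]], (L1 y z g) as [lg [Hg1 Hg2]]; simpl.
    apply tot_inj, Hfaith'; trivial.
    + rewrite H1, !fmap_comp; symmetry; now apply tot_comp.
    + rewrite H2, !fmap_comp; symmetry; now apply tot_comp.
  - assert (HL : functor_comp top L = S /\ functor_comp left L = T).
    { split; apply functor_ext.
      - intros x; apply (proj2_sig (L0 x)).
      - intros x y f; apply (proj2_sig (L1 x y f)).
      - intros x; apply (proj2_sig (L0 x)).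
      - intros x y f; apply (proj2_sig (L1 x y f)). }
    exists L; split; [exact HL |].
    intros L' [HL'1 HL'2]; destruct HL as [HL1 HL2].
    rewrite <- HL'1 in HL1; rewrite <- HL'2 in HL2.
    assert (Hob : forall x, L x = L' x).
    { intros x; apply Hinj.
      - exact (f_equal (fun F => fobj F x) HL1).
      - exact (f_equal (fun F => fobj F x) HL2). }
    apply functor_ext; [exact Hob |].
    intros x y f; apply Hfaith'; trivial.
    + exact (f_equal (fun F => tot (fmap F f)) HL1).
    + exact (f_equal (fun F => tot (fmap F f)) HL2).
Qed.

(** The two upper corners are replaced along the isomorphisms [i] and [j]. The mediating functor is
    [i' L], with [L] induced by [j S] and [T]. *)
Lemma pullback_transfer {P A C D P' A' : Category}
    (top : Functor P A) (left : Functor P C)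
    (right : Functor A D) (bottom : Functor C D)
    (i : Functor P' P) (i' : Functor P P') (j : Functor A' A)
    (j' : Functor A A') (top' : Functor P' A') :
  inverse_functors i i' -> inverse_functors j j' ->
  functor_comp j top' = functor_comp top i ->
  is_pullback top left right bottom ->
  is_pullback top' (functor_comp left i) (functor_comp right j) bottom.
Proof.
  intros [Hi1 Hi2] [Hj1 Hj2] Hij [Hsq HP]; split.
  { now rewrite <- functor_comp_assoc, Hij, !functor_comp_assoc, Hsq. }
  intros X S T HST.
  rewrite <- functor_comp_assoc in HST.
  destruct (HP X (functor_comp j S) T HST) as [L [[HL1 HL2] HL]].
  exists (functor_comp i' L); repeat split.
  - rewrite <- (functor_comp_id_l (functor_comp top' _)), <- Hj1.
    rewrite <- (functor_comp_assoc j' j), (functor_comp_assoc j top'), Hij.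
    rewrite <- (functor_comp_assoc top i), (functor_comp_assoc i i'), Hi2.
    rewrite functor_comp_id_l, HL1, functor_comp_assoc, Hj1.
    apply functor_comp_id_l.
  - rewrite <- functor_comp_assoc, (functor_comp_assoc i i'), Hi2.
    now rewrite functor_comp_id_l.
  - intros K [HK1 HK2].
    rewrite (HL (functor_comp i K)).
    + now rewrite functor_comp_assoc, Hi1, functor_comp_id_l.
    + now rewrite functor_comp_assoc, <- Hij, <- functor_comp_assoc, HK1,
        functor_comp_assoc, HK2.
Qed.

(** * Invariance of cartesian 1-cells and finality under isomorphism of 2-categories *)

Lemma fhom_postcomp {E D : TwoCategory} (F : TwoFunctor E D) (a u v : E)
    (f : hom u v) :
  functor_comp (@fhom _ _ F a v) (postcomp a f) =
  functor_comp (postcomp (F a) (fhom F f)) (@fhom _ _ F a u).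
Proof.
  apply functor_ext.
  - intros h; apply fhom_comp1.
  - intros h h' al; simpl; unfold whisker_l.
    eapply eq_trans; [apply fhom_comp2 |].
    now rewrite fmap_id.
Qed.

Section TwoIsomorphism.
Variables (E D : TwoCategory) (F : TwoFunctor E D) (G : TwoFunctor D E).
Hypothesis (HGF : two_functor_comp G F = two_functor_id E).
Hypothesis (HFG : two_functor_comp F G = two_functor_id D).

Lemma fhom_inverse_of_eq_id {A : TwoCategory} (K : TwoFunctor A A) :
  K = two_functor_id A ->
  forall a b : A, exists R : Functor (hom (K a) (K b)) (hom a b),
    inverse_functors (@fhom _ _ K a b) R.
Proof.
  intros -> a b; exists (functor_id _); split; apply functor_comp_id_l.
Qed.

(** On homs [G] lands in [hom (G (F a)) (G (F b))] rather than [hom a b]; composing with the inverse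
    [R] of [G F] on homs corrects this. *)
Lemma fhom_inverse (a b : E) :
  exists R : Functor (hom (F a) (F b)) (hom a b),
    inverse_functors (@fhom _ _ F a b) R.
Proof.
  destruct (fhom_inverse_of_eq_id HGF a b) as [R [HR1 HR2]].
  destruct (fhom_inverse_of_eq_id HFG (F a) (F b)) as [Q [HQ1 _]].
  pose (g := @fhom _ _ G (F a) (F b)); pose (f := @fhom _ _ F a b).
  pose (h := @fhom _ _ F (G (F a)) (G (F b))).
  change (functor_comp R (functor_comp g f) = functor_id _) in HR1.
  change (functor_comp (functor_comp g f) R = functor_id _) in HR2.
  change (functor_comp Q (functor_comp h g) = functor_id _) in HQ1.
  exists (functor_comp R g); split; fold f.
  - now rewrite <- functor_comp_assoc.
  - (* [Q h] is a left inverse of [g], and [g (f R g) = g]. *)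
    rewrite <- (functor_comp_id_l (functor_comp f _)), <- HQ1 at 1.
    rewrite <- !functor_comp_assoc, (functor_comp_assoc f R g).
    rewrite (functor_comp_assoc g (functor_comp f R) g).
    rewrite (functor_comp_assoc g f R), HR2, functor_comp_id_l.
    exact HQ1.
Qed.

Lemma two_iso_surj (s : D) : exists a : E, F a = s.
Proof. exists (G s); exact (f_equal (fun K => fob K s) HFG). Qed.

(** The two squares differ by the isomorphisms that [F] induces on the upper hom-categories, and
    every test object of [D] has the form [F a]. *)
Lemma cartesian1_transfer {B : TwoCategory} (q : TwoFunctor D B) (u v : E)
    (f : hom u v) :
  cartesian1 (two_functor_comp q F) f <-> cartesian1 q (fhom F f).
Proof.
  split; intros Hf.
  - intros s; destruct (two_iso_surj s) as [a <-].
    destruct (fhom_inverse a u) as [R HR], (fhom_inverse a v) as [Q HQ].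
    specialize (Hf a).
    change (is_pullback (postcomp a f)
      (functor_comp (@fhom _ _ q (F a) (F u)) (@fhom _ _ F a u))
      (functor_comp (@fhom _ _ q (F a) (F v)) (@fhom _ _ F a v))
      (postcomp (q (F a)) (fhom q (fhom F f)))) in Hf.
    apply (@pullback_transfer _ _ _ _ _ _ _ _ _ _ R (fhom F) Q (fhom F)
             (postcomp (F a) (fhom F f))) in Hf.
    + rewrite <- !functor_comp_assoc, (proj2 HR), (proj2 HQ) in Hf.
      now rewrite !functor_comp_id_r in Hf.
    + now apply inverse_functors_sym.
    + now apply inverse_functors_sym.
    + rewrite <- (functor_comp_id_l (functor_comp (postcomp a f) R)).
      rewrite <- (proj1 HQ), <- (functor_comp_assoc Q).
      rewrite (functor_comp_assoc _ _ R), fhom_postcomp.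
      now rewrite <- (functor_comp_assoc _ _ R), (proj2 HR), functor_comp_id_r.
  - intros a.
    destruct (fhom_inverse a u) as [R HR], (fhom_inverse a v) as [Q HQ].
    exact (pullback_transfer HR HQ (fhom_postcomp F a f) (Hf (F a))).
Qed.

Lemma M_final_transfer {B : TwoCategory} (q : TwoFunctor D B) (c : E) :
  M_final (M_cart q) (F c) -> M_final (M_cart (two_functor_comp q F)) c.
Proof.
  intros [H1 [H2 [H3 H4]]]; repeat split.
  - intros a; destruct (fhom_inverse a c) as [R HR].
    destruct (H1 (F a)) as [t Ht]; exists (R t).
    exact (inverse_functors_terminal (inverse_functors_sym HR) Ht).
  - destruct (fhom_inverse c c) as [R HR].
    apply (terminal_reflect HR); now rewrite fhom_id1.
  - intros a; destruct (fhom_inverse a c) as [R HR].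
    destruct (H3 (F a)) as [f Hf]; exists (R f).
    apply cartesian1_transfer.
    now rewrite (f_equal (fun K => fobj K f) (proj2 HR) : fhom F (R f) = f).
  - intros a b f Hf t Ht.
    apply cartesian1_transfer in Hf.
    destruct (fhom_inverse a c) as [R HR], (fhom_inverse b c) as [Q HQ].
    apply (terminal_reflect HR); simpl; rewrite fhom_comp1.
    exact (H4 _ _ _ Hf _ (inverse_functors_terminal HQ Ht)).
Qed.

End TwoIsomorphism.

(** * Fillers, terminal 1-cells and cartesian 1-cells in the lax slice *)

Section Slice.
Variables (B : TwoCategory) (x : B).

Lemma fill_congr (u v : LaxSlice x) (s t : Slice1 u v) :
  s = t -> fill s ≅ fill t.
Proof. now intros ->. Qed.

Lemma tot_hcomp_eq_id_r {a b : B} (i : hom a a) {f f' : hom a b}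
    (al : arr f f') : i = id1 a -> al ⋆ idn i ≅ al.
Proof. intros ->; apply hcomp_unit_r. Qed.

(** Whiskering with [id1 x] is bijective on 2-cells, so a 2-cell from [t] to [s] is forced to be the
    one whose whiskering is the inverse of [fill s] after [fill t]. *)
Lemma invertible_fill_terminal (u : LaxSlice x) (s : Slice1 u (slice_id_ob x)) :
  invertible (fill s) -> terminal (s : slice_hom u (slice_id_ob x)).
Proof.
  intros [g [Hg1 Hg2]] t.
  destruct (fully_faithful_of_eq_id (postcomp_id1 (base u) x) (g ∘ fill t))
    as [X [HX Huniq]].
  unshelve eexists.
  { exists X; simpl in HX |- *; rewrite HX.
    etransitivity; [apply comp_assoc |].
    etransitivity; [apply (f_equal (fun h => h ∘ fill t) Hg2) |].
    apply comp_id_l. }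
  intros Y; apply slice2_eq; simpl; symmetry; apply Huniq.
  rewrite <- (cell2_fill Y), comp_assoc, Hg1, comp_id_l; reflexivity.
Qed.

(** This is the 1-cell (α, 1); the [eq_arr] only records the strict unit law. *)
Definition slice_canonical (u : LaxSlice x) : Slice1 u (slice_id_ob x) :=
  @Build_Slice1 B x u (slice_id_ob x) (leg u) (eq_arr (unit1_l (leg u))).

(** Terminal objects are isomorphic, so [fill s] is the invertible filler of [slice_canonical u]
    composed with a whiskered isomorphism. *)
Lemma terminal_invertible_fill (u : LaxSlice x) (s : Slice1 u (slice_id_ob x)) :
  terminal (s : slice_hom u (slice_id_ob x)) -> invertible (fill s).
Proof.
  intros Hs.
  assert (Ht := invertible_fill_terminal (s := slice_canonical u)
                  (invertible_eq_arr _)).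
  destruct (Ht s) as [Y _].
  destruct (terminal_invertible Y Hs Ht) as [X [HX1 HX2]].
  rewrite <- (cell2_fill Y); apply invertible_comp.
  - apply invertible_eq_arr.
  - apply (invertible_fmap (postcomp (base u) (leg (slice_id_ob x)))).
    exists (cell2 X); split.
    + exact (f_equal (fun Z => cell2 Z) HX1).
    + exact (f_equal (fun Z => cell2 Z) HX2).
Qed.

Lemma invertible_slice_comp (u v w : LaxSlice x) (t : Slice1 v w)
    (s : Slice1 u v) :
  invertible (fill t) -> invertible (fill s) ->
  invertible (fill (slice_comp_ob t s)).
Proof.
  intros Ht Hs; apply invertible_comp; [exact Hs |].
  apply invertible_comp; [| apply invertible_eq_arr].
  exact (invertible_fmap (precomp (cell1 s) x) Ht).
Qed.

Lemma cartesian_invertible_fill (u v : LaxSlice x) (f : Slice1 u v) :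
  cartesian1 (slice_proj x) (f : hom u v) -> invertible (fill f).
Proof.
  intros Hf.
  (* Writing [f] as (f, γ) : (y, α) -> (z, β), these are [u'] = (y, βf), [s] = (f, 1) : [u'] -> [v]
     and [h] = (1, γ) : [u] -> [u']. *)
  pose (u' := {| base := base u; leg := leg v · cell1 f |} : LaxSlice x).
  pose (s := @Build_Slice1 B x u' v (cell1 f) (idn _)).
  pose (h := @Build_Slice1 B x u u' (id1 (base u))
               (fill f ∘ eq_arr (unit1_r (leg v · cell1 f)))).
  destruct (pullback_obj (Hf u') (s := s) (t := id1 (base u)))
    as [k [[Hk1 Hk2] _]]; [symmetry; apply unit1_r |].
  change (slice_comp_ob f k = s) in Hk1; change (cell1 k = id1 (base u)) in Hk2.
  (* Both [k h] and the identity lie over the identity, and f(kh) = sh = f, so uniqueness of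
     factorizations through [f] identifies them. *)
  assert (Hkh : slice_comp_ob k h = slice_id1 u).
  { destruct (pullback_obj (Hf u) (s := f) (t := id1 (base u)))
      as [l [_ Hl]]; [symmetry; apply unit1_r |].
    transitivity l; [symmetry |]; apply Hl; split.
    - transitivity (slice_comp_ob (slice_comp_ob f k) h);
        [apply (slice_assoc1 f k h) |].
      rewrite Hk1; apply slice1_eq; [apply unit1_r |].
      eapply eq_trans; [apply tot_slice_fill |].
      eapply eq_trans; [| apply f_equal, comp_id_r].
      apply tot_comp; [apply tot_eq_arr_r |].
      simpl; unfold whisker_r; apply hcomp_unit_r.
    - simpl; rewrite Hk2; apply unit1_r.
    - apply (slice_unit1_r (f : slice_hom u v)).
    - reflexivity. }
  assert (e : leg u = leg u · cell1 k) by now rewrite Hk2, unit1_r.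
  (* The equation fk = s gives κγ = 1 and kh = 1 gives γκ = 1, where κ is [fill k]; [eq_arr e]
     absorbs the equality of [cell1 k] with the identity. *)
  exists (fill k ∘ eq_arr e); split; apply tot_inj.
  - eapply eq_trans; [| apply (@fill_congr u' v _ _ Hk1)].
    eapply eq_trans; [| symmetry; apply (@tot_slice_fill B x u' u v f k)].
    apply tot_comp; [apply tot_eq_arr_r |].
    symmetry; now apply tot_hcomp_eq_id_r.
  - transitivity (tot (fill (slice_comp_ob k h))).
    + eapply eq_trans; [| symmetry; apply (@tot_slice_fill B x u u' u k h)].
      apply tot_comp; [symmetry; apply tot_eq_arr_r |].
      eapply eq_trans; [apply tot_eq_arr_r |].
      symmetry; now apply tot_hcomp_eq_id_r.
    + rewrite Hkh; apply tot_eq_arr.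
Qed.

Lemma invertible_fill_cartesian (u v : LaxSlice x) (f : Slice1 u v) :
  invertible (fill f) -> cartesian1 (slice_proj x) (f : hom u v).
Proof.
  intros Hf w.
  (* Composing a 1-cell over [t] with [f] multiplies its filler on the right by [m t]; everything
     below divides by this invertible 2-cell. *)
  pose (m := fun t : hom (base w) (base u) =>
    whisker_r (fill f) t ∘ eq_arr (assoc1 (leg v) (cell1 f) t)).
  assert (Hm : forall t, invertible (m t)).
  { intros t; apply invertible_comp; [| apply invertible_eq_arr].
    exact (invertible_fmap (precomp t x) Hf). }
  apply pullback_of_obj_arr.
  - now apply functor_ext.
  - intros [c ga] t Hc; simpl in Hc; subst c.
    destruct (Hm t) as [n [Hn _]].
    exists (@Build_Slice1 B x w u t (ga ∘ n)); split; [| reflexivity].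
    apply slice1_eq; [reflexivity |]; simpl; fold (m t).
    now rewrite <- comp_assoc, Hn, comp_id_r.
  - intros [c ga] [c' ga'] H1 H2; simpl in H2; subst c'.
    apply slice1_eq; [reflexivity |]; simpl; f_equal; f_equal.
    apply (invertible_epi (Hm c)), tot_inj; exact (fill_congr H1).
  - intros l l' sg ta H; simpl in l, l', sg, ta, H.
    apply tot_inj in H.
    unshelve eexists.
    + exists ta.
      (* After composition with [m], the filler equation for [ta] becomes the one satisfied by [sg];
         interchange slides [ta] past [fill f]. *)
      apply (invertible_epi (Hm (cell1 l))).
      transitivity (fill (slice_comp_ob f l) : arr _ _); [| reflexivity].
      rewrite <- (cell2_fill sg), H; simpl; fold (m (cell1 l')).
      rewrite <- !comp_assoc; f_equal.
      apply tot_inj.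
      transitivity (tot ((whisker_r (fill f) (cell1 l')) ∘
                         ((idn (leg v) ⋆ idn (cell1 f)) ⋆ ta))).
      * transitivity (tot ((idn (leg u) ⋆ ta) ∘ (fill f ⋆ idn (cell1 l)))).
        { apply tot_comp; [reflexivity | apply tot_eq_arr_r]. }
        unfold whisker_r; rewrite hcomp_idn, !interchange.
        now rewrite !comp_id_l, !comp_id_r.
      * symmetry; apply tot_comp; [apply tot_eq_arr_r | apply hcomp_assoc].
    + split; [apply slice2_eq; now symmetry | reflexivity].
  - intros l l' la la' _ H; apply slice2_eq; exact H.
Qed.

Lemma slice_id_ob_final : M_final (M_cart (slice_proj x)) (slice_id_ob x).
Proof.
  repeat split.
  - intros u; exists (slice_canonical u).
    apply invertible_fill_terminal, invertible_eq_arr.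
  - apply invertible_fill_terminal, invertible_eq_arr.
  - intros u; exists (slice_canonical u).
    apply invertible_fill_cartesian, invertible_eq_arr.
  - intros u v f Hf t Ht.
    apply invertible_fill_terminal, invertible_slice_comp.
    + now apply terminal_invertible_fill.
    + now apply cartesian_invertible_fill.
Qed.

End Slice.

Theorem proposition3p2p1 (E B : TwoCategory) (p : TwoFunctor E B)
    (hp : two_fibration p) (x : B) (r : RepresentedBy p x) :
  M_final (M_cart p) (associated_lift r).
Proof.
  clear hp.
  (* Substituting for [p] the projection composed with [F] gives the form in which finality
     transfers along [F]. *)
  destruct r as [F G HGF HFG Hp]; subst p; unfold associated_lift; simpl.
  apply (M_final_transfer HGF HFG).
  (* [F] sends the associated lift back to (x, 1), whose finality is computed in the slice. *)
  rewrite (f_equal (fun K => fob K (slice_id_ob x)) HFG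
             : F (G (slice_id_ob x)) = slice_id_ob x).
  apply slice_id_ob_final.
Qed.
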